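(* Let $n\ge2$ and let $(V,E)$ be an $n$-uniform and connected hypergraph. Define $d:V^n\to\mathbb{R}$ as follows: $d(v_1,\ldots,v_n)=0$ if $v_i=v_j$ for some $i\ne j$; otherwise, with $W=\{v_1,\ldots,v_n\}$, $$d(v_1,\ldots,v_n)=\min\{\#P: P \text{ is a connected component of } (V,E) \text{ connecting } W\}.$$ Then $d$ is a pseudo $n$-metric on $V$.
   Context: A hypergraph is a pair $(V,E)$ where $V$ is a finite set and $E$ is a subset of the power set of $V$; elements of $E$ are called hyperedges. It is $n$-uniform if every hyperedge has exactly $n$ elements. Let $(V,E)$ be an $n$-uniform hypergraph. A subset $P\subset E$ is called a connected component of $(V,E)$ (no maximality is required) if for any two $e_0,e_\infty\in P$ there exist finitely many $e_1,\ldots,e_k\in P$ such that $e_{i-1}\cap e_i\ne\emptyset$ for $i=1,\ldots,k+1$, where $e_{k+1}:=e_\infty$. A subset $W\subset\bigcup_{e\in P}e$ is said to be connected by $P$ (equivalently, $P$ connects $W$). The hypergraph is called connected if $E$ itself is a connected component of $(V,E)$ and $V=\bigcup_{e\in E}e$. For $n\ge2$ and a set $X$, a map $d:X^n\to\mathbb{R}$ is a pseudo $n$-metric on $X$ if (i) $d(x_1,\ldots,x_n)=0$ whenever $x_i=x_j$ for some $i\ne j$; (ii) $d(x_{\pi(1)},\ldots,x_{\pi(n)})=d(x_1,\ldots,x_n)$ for all permutations $\pi$ of $\{1,\ldots,n\}$; (iii) $d(x_1,\ldots,x_n)\le\sum_{i=1}^n d(x_1,\ldots,x_{i-1},y,x_{i+1},\ldots,x_n)$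 for all $x_1,\ldots,x_n,y\in X$. *)

(* Defs.v *)
From HB Require Import structures.
From mathcomp Require Import all_boot all_order all_fingroup all_algebra.
From mathcomp Require Import boolp reals.
Set Implicit Arguments.
Unset Strict Implicit.
Unset Printing Implicit Defensive.
Local Open Scope ring_scope.

(* A hypergraph is given by its vertex type V and its set E of hyperedges. *)

Definition uniform_hypergraph (n : nat) (V : finType) (E : {set {set V}})
  : Prop := forall e : {set V}, e \in E -> #|e| = n.

(* The sequence es is e_1, ..., e_k, with k = 0 allowed. *)
Definition connected_family (V : finType) (P : {set {set V}}) : Prop :=
  forall e0 einf : {set V}, e0 \in P -> einf \in P ->
    exists2 es : seq {set V}, {subset es <= P} &
      path (fun e f : {set V} => e :&: f != set0) e0 (rcons es einf).

Definition connected_component (V : finType) (E P : {set {set V}}) : Prop :=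
  P \subset E /\ connected_family P.

Definition connects (V : finType) (E P : {set {set V}}) (W : {set V}) : Prop :=
  connected_component E P /\ W \subset cover P.

Definition connected_hypergraph (V : finType) (E : {set {set V}}) : Prop :=
  connected_component E E /\ cover E = [set: V].

(* X^n is represented by {ffun 'I_n -> X}. *)
Record pseudo_nmetric (R : realType) (n : nat) (X : Type)
    (d : {ffun 'I_n -> X} -> R) : Prop := PseudoNMetric {
  pseudo_nmetric_eq0 : forall (x : {ffun 'I_n -> X}) (i j : 'I_n),
    i != j -> x i = x j -> d x = 0;
  pseudo_nmetric_sym : forall (x : {ffun 'I_n -> X}) (pi : {perm 'I_n}),
    d [ffun i => x (pi i)] = d x;
  pseudo_nmetric_simplex : forall (x : {ffun 'I_n -> X}) (y : X),
    d x <= \sum_(i < n) d [ffun j => if j == i then y else x j]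
}.

(* The default value E of the arg min is a junk value only if no P connects *)
(* W, which cannot happen when (V, E) is connected.                          *)
Definition connection_number (V : finType) (E : {set {set V}}) (W : {set V})
  : nat := #|[arg min_(P < E | `[< connects E P W >]) #|P|]%N|.

Definition hypergraph_dist (R : realType) (n : nat) (V : finType)
    (E : {set {set V}}) (v : {ffun 'I_n -> V}) : R :=
  if [exists i, exists j, (i != j) && (v i == v j)] then 0
  else (connection_number E [set v i | i : 'I_n])%:R.

(* Main.v *)
(* For the simplex inequality, take optimal components P_i for the tuples with
   x_i replaced by y, where y is not one of the x_i.  Each P_i covers y, so the
   union of the P_i is again a connected component; it covers every x_j, because
   x_j is covered by any P_i with i <> j, and has at most \sum_i #|P_i| edges. *)
Require Import Defs.
From HB Require Import structures.
From mathcomp Require Import all_boot all_order all_fingroup all_algebra.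
From mathcomp Require Import boolp reals.
Set Implicit Arguments.
Unset Strict Implicit.
Unset Printing Implicit Defensive.
Local Open Scope ring_scope.
Import Order.TTheory GRing.Theory Num.Theory.

(** The vertex [y] is a common meeting point: a chain runs inside [P i] from [e0] to an edge [f]
    through [y], crosses to an edge [g] of [P j] through [y], and goes on inside [P j] to [einf]. *)
Lemma connected_family_bigcup (V I : finType) (P : I -> {set {set V}}) (y : V) :
    (forall i, connected_family (P i)) -> (forall i, y \in cover (P i)) ->
  connected_family (\bigcup_i P i).
Proof.
move=> connP Py e0 einf /bigcupP[i _ e0P] /bigcupP[j _ einfP].
have /bigcupP[f fP yf] := Py i; have /bigcupP[g gP yg] := Py j.
have [s sP e0f] := connP i _ _ e0P fP.
have [t tP ginf] := connP j _ _ gP einfP.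
exists (s ++ f :: g :: t).
  move=> e; rewrite mem_cat !inE => /or4P[/sP|/eqP->|/eqP->|/tP] *;
    by apply/bigcupP; solve [exists i => // | exists j => //].
(* Regrouped as [rcons s f ++ g :: rcons t einf], the path consists of the two given ones and the
   junction [f :&: g != set0]. *)
rewrite rcons_cat rcons_cons -cat_rcons cat_path e0f last_rcons /= ginf andbT.
by apply/set0Pn; exists y; rewrite inE yf.
Qed.

Lemma card_bigcup_le (T I : finType) (P : I -> {set T}) :
  (#|\bigcup_i P i| <= \sum_i #|P i|)%N.
Proof.
elim/big_rec2: _ => [|i m A _ leAm]; first by rewrite cards0.
by rewrite (leq_trans (leq_card_setU _ _)) // leq_add2l.
Qed.

Section ConnectionNumber.
Variables (V : finType) (E : {set {set V}}).
Hypothesis connE : connected_hypergraph E.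

(** Here connectedness of the hypergraph enters: [E] is always a candidate, so the arg min in
    [connection_number] is a genuine minimum. *)
Lemma connectsT (W : {set V}) : connects E E W.
Proof. by case: connE => ? covE; split=> //; rewrite covE subsetT. Qed.

Lemma connection_numberP (W : {set V}) :
  exists2 P, connects E P W & #|P| = connection_number E W.
Proof.
rewrite /connection_number; case: arg_minnP => [|P /asboolP PW _].
  exact/asboolP/connectsT.
by exists P.
Qed.

Lemma connection_number_le (P : {set {set V}}) (W : {set V}) :
  connects E P W -> (connection_number E W <= #|P|)%N.
Proof.
move=> PW; rewrite /connection_number; case: arg_minnP => [|Q _ minQ].
  exact/asboolP/connectsT.
exact/minQ/asboolP.
Qed.

(** Working with [connection_number] on arbitrary tuples leaves the zero convention for repeated
    entries to the final theorem. *)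
Lemma connection_number_simplex (n : nat) (x : {ffun 'I_n -> V}) (y : V) :
    (2 <= n)%N ->
  (connection_number E [set x i | i : 'I_n] <=
   \sum_(i < n) connection_number E
     [set [ffun k => if k == i then y else x k] j | j : 'I_n])%N.
Proof.
move=> n_ge2; pose xy i := [ffun k : 'I_n => if k == i then y else x k].
pose optimal i (P : {set {set V}}) := connects E P [set xy i j | j : 'I_n] /\
  #|P| = connection_number E [set xy i j | j : 'I_n].
have exP i : exists P, optimal i P.
  by have [P PW szP] := connection_numberP [set xy i j | j : 'I_n]; exists P.
have [P optP] := choice exP.
have covP i j : xy i j \in cover (P i).
  by have [[_ /subsetP sub] _] := optP i; apply/sub/imset_f.
under eq_bigr do rewrite -(optP _).2.
apply: leq_trans (card_bigcup_le P); apply: connection_number_le.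
split; first split.
- by apply/bigcupsP => i _; case: (optP i) => -[[]].
- apply: (@connected_family_bigcup _ _ _ y) => i; first by case: (optP i) => -[[]].
  by have := covP i i; rewrite ffunE eqxx.
apply/subsetP => _ /imsetP[j _ ->].
(* This is where [2 <= n] matters: replacing an entry at an index other than [j] keeps [x j] in the
   tuple. *)
have [i ne_ji] : exists i, j != i.
  have /subsetPn[i _] : ~~ ([set: 'I_n] \subset [set j]).
    by apply/negP => /subset_leq_card; rewrite cardsT card_ord cards1 leqNgt n_ge2.
  by rewrite inE eq_sym; exists i.
have := covP i j; rewrite ffunE (negPf ne_ji) => /bigcupP[e eP xe].
by apply/bigcupP; exists e => //; apply/bigcupP; exists i.
Qed.

End ConnectionNumber.

Lemma hypergraph_distE (R : realType) (n : nat) (V : finType)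
    (E : {set {set V}}) (v : {ffun 'I_n -> V}) :
  hypergraph_dist R E v =
    if injectiveb v then (connection_number E [set v i | i : 'I_n])%:R else 0.
Proof.
rewrite /hypergraph_dist; case: injectiveP => [injv|ninjv].
  by case: existsP => // -[i /existsP[j /andP[/eqP ne_ij /eqP/injv]]].
case: existsP => // noncoll; case: ninjv => i j eq_v; apply/eqP.
apply/negPn/negP => ne_ij; case: noncoll.
by exists i; apply/existsP; exists j; rewrite ne_ij eq_v eqxx.
Qed.

Lemma hypergraph_dist_ge0 (R : realType) (n : nat) (V : finType)
    (E : {set {set V}}) (v : {ffun 'I_n -> V}) : 0 <= hypergraph_dist R E v.
Proof. by rewrite hypergraph_distE; case: ifP. Qed.

Theorem proposition5p5 (R : realType) (n : nat) (V : finType)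
    (E : {set {set V}}) (n_ge2 : (2 <= n)%N)
    (unifE : uniform_hypergraph n E) (connE : connected_hypergraph E) :
  pseudo_nmetric (@hypergraph_dist R n V E).
Proof.
split=> [x i j ne_ij eq_x|x pi|x y].
- rewrite hypergraph_distE; case: injectiveP => // injx.
  by rewrite (injx _ _ eq_x) eqxx in ne_ij.
- rewrite !hypergraph_distE.
  have -> : [set [ffun i => x (pi i)] i | i : 'I_n] = [set x i | i : 'I_n].
    apply/setP => z; apply/imsetP/imsetP => -[i _ ->].
      by exists (pi i); rewrite ?ffunE.
    by exists ((pi^-1)%g i); rewrite ?ffunE ?permKV.
  congr (if _ then _ else _); apply/injectiveP/injectiveP => injx i j.
    move=> eq_x; apply: (@perm_inj _ (pi^-1)%g); apply: injx.
    by rewrite !ffunE !permKV.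
  by rewrite !ffunE => /injx/perm_inj.
(* If [x] has a repeated entry, the left side is 0 and the right side is a sum of nonnegative
   terms. *)
rewrite {1}hypergraph_distE; case: injectiveP => [injx|_]; last first.
  by apply: sumr_ge0 => i _; apply: hypergraph_dist_ge0.
(* If [y] is some [x i], replacing [x i] by [y] changes nothing, so the [i]-th term alone equals the
   left side. *)
have [/existsP[i /eqP xi]|/existsPn xNy] := boolP [exists i, x i == y].
  rewrite (bigD1 i) //= -[leLHS]addr0; apply: lerD; last first.
    by apply: sumr_ge0 => j _; apply: hypergraph_dist_ge0.
  have -> : [ffun j => if j == i then y else x j] = x.
    by apply/ffunP => j; rewrite ffunE; case: eqP => [->|].
  by rewrite hypergraph_distE; move/injectiveP: injx => ->.
(* Now [y] is distinct from all entries of the injective [x], so every modified tuple is injective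
   too and no term on the right falls under the zero convention. *)
apply: (@le_trans _ _ (\sum_(i < n) connection_number E
    [set [ffun k => if k == i then y else x k] j | j : 'I_n])%:R).
  by rewrite ler_nat; apply: connection_number_simplex.
rewrite natr_sum; apply: ler_sum => i _; rewrite hypergraph_distE.
case: injectiveP => // -[] j k; rewrite !ffunE.
case: eqP => [->|_]; case: eqP => [->|_] //.
- by move=> /esym/eqP; rewrite (negPf (xNy k)).
- by move=> /eqP; rewrite (negPf (xNy j)).
exact: injx.
Qed.
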